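(* Let $k>1$ be an integer and let $\widetilde{\mathbb{Z}}$ be a ring elementarily equivalent to $\mathbb{Z}$. Then the group $BS(1,k,\widetilde{\mathbb{Z}})$ is a $\widetilde{\mathbb{Z}}$-group, i.e. it admits an exponentiation $G\times\widetilde{\mathbb{Z}}\to G$, $(g,\alpha)\mapsto g^\alpha$, satisfying: (1) $g^1=g$, $g^0=e$ for all $g$, and $e^\alpha=e$ for all $\alpha$; (2) $g^{\alpha+\beta}=g^\alpha g^\beta$ and $g^{\alpha\beta}=(g^\alpha)^\beta$ for all $g,\alpha,\beta$; (3) $(h^{-1}gh)^\alpha=h^{-1}g^\alpha h$ for all $g,h,\alpha$; (4) if $gh=hg$ then $(gh)^\alpha=g^\alpha h^\alpha$.
   Context: Let $\widetilde{\mathbb{Z}}\equiv\mathbb{Z}$ in the ring language $\{+,\cdot,0,1\}$. The standard integers embed in $\widetilde{\mathbb{Z}}$; the formula defining the positive integers (via Lagrange's four-square theorem) defines $\widetilde{\mathbb{Z}}^+$ and an order on $\widetilde{\mathbb{Z}}$. The first-order formula defining in $\mathbb{Z}$ the exponentiation $x=y^z$ ($z\ge 0$) defines in $\widetilde{\mathbb{Z}}$ an exponentiation; in particular for the integer $k$ and $i\in\widetilde{\mathbb{Z}}$, $i\ge0$, there is a unique $k^i\in\widetilde{\mathbb{Z}}$, with $k^0=1$, $k^{i_1}k^{i_2}=k^{i_1+i_2}$. Let $S=\{k^i: i\in\widetilde{\mathbb{Z}}^+\}\cup\{1\}$ and let $\widetilde{\mathbb{Z}}[1/k^{\widetilde{\mathbb{Z}}}]=S^{-1}\widetilde{\mathbb{Z}}$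 be the ring of fractions; write $k^{-i}=1/k^i$, so $k^i$ is defined for all $i\in\widetilde{\mathbb{Z}}$. Define $BS(1,k,\widetilde{\mathbb{Z}})=\widetilde{\mathbb{Z}}[1/k^{\widetilde{\mathbb{Z}}}]\rtimes\widetilde{\mathbb{Z}}$ (additive groups), i.e. the set of pairs $(x,m)$ with $x\in\widetilde{\mathbb{Z}}[1/k^{\widetilde{\mathbb{Z}}}]$, $m\in\widetilde{\mathbb{Z}}$, and product $(x_1,m_1)(x_2,m_2)=(x_1+x_2k^{-m_1},\,m_1+m_2)$. *)

(* Defs.v *)
From HB Require Import structures.
From mathcomp Require Import all_boot all_order all_algebra.
From Stdlib Require Import ClassicalEpsilon.
Set Implicit Arguments. Unset Strict Implicit. Unset Printing Implicit Defensive.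
Import Order.TTheory GRing.Theory Num.Theory.
Local Open Scope ring_scope.

Inductive rterm : Type :=
  | RVar of nat | RZero | ROne | RAdd of rterm & rterm | RMul of rterm & rterm.

Inductive rform : Type :=
  | REq of rterm & rterm | RNot of rform | RAnd of rform & rform | REx of nat & rform.

Fixpoint teval (R : pzSemiRingType) (e : nat -> R) (t : rterm) : R :=
  match t with
  | RVar n => e n | RZero => 0 | ROne => 1
  | RAdd a b => teval e a + teval e b
  | RMul a b => teval e a * teval e b
  end.

Fixpoint fholds (R : pzSemiRingType) (e : nat -> R) (f : rform) : Prop :=
  match f with
  | REq a b => teval e a = teval e b
  | RNot g => ~ fholds e g
  | RAnd g h => fholds e g /\ fholds e h
  | REx n g => exists x : R, fholds (fun m => if m == n then x else e m) g
  end.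

Fixpoint tfree (n : nat) (t : rterm) : bool :=
  match t with
  | RVar m => m == n | RZero | ROne => false
  | RAdd a b | RMul a b => tfree n a || tfree n b
  end.

Fixpoint ffree (n : nat) (f : rform) : bool :=
  match f with
  | REq a b => tfree n a || tfree n b
  | RNot g => ffree n g
  | RAnd g h => ffree n g || ffree n h
  | REx m g => (n != m) && ffree n g
  end.

Definition sentence (f : rform) : Prop := forall n, ~~ ffree n f.

Definition elem_equiv_Z (R : pzSemiRingType) : Prop :=
  forall f, sentence f ->
    (fholds (fun _ => 0 : R) f <-> fholds (fun _ => 0 : int) f).

(* nonnegative elements (Lagrange four squares) *)
Definition nonnegR (R : pzSemiRingType) (i : R) : Prop :=
  exists a b c d : R, i = a * a + b * b + c * c + d * d.

Definition defines_exp (phi : rform) : Prop :=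
  (forall n, ffree n phi -> (n <= 2)%N) /\
  forall e : nat -> int,
    fholds e phi <-> ((0 <= e 2%N) /\ e 0%N = e 1%N ^+ `|e 2%N|%N).

Definition env3 (R : pzSemiRingType) (x y z : R) (n : nat) : R :=
  match n with 0 => x | 1 => y | 2 => z | _ => 0 end.

Definition Rexp (R : pzSemiRingType) (x y z : R) : Prop :=
  exists phi, defines_exp phi /\ fholds (env3 x y z) phi.

Definition kpow (R : pzSemiRingType) (k : nat) (i : R) : R :=
  epsilon (inhabits 0) (fun x => Rexp x k%:R i).

Section BS.
Variables (R : idomainType) (k : nat).
Local Notation "x %:F" := (@FracField.tofrac R x).

Definition kpowF (i : R) : {fraction R} :=
  epsilon (inhabits 0) (fun y : {fraction R} =>
    (nonnegR i -> y = (kpow k i)%:F) /\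
    (~ nonnegR i -> y = ((kpow k (- i))%:F)^-1)).

(* membership in R[1/k^R] = S^{-1} R, S = {k^i : i >= 0}, inside Frac(R) *)
Definition inLoc (x : {fraction R}) : Prop :=
  exists (a i : R), nonnegR i /\ x = a%:F / (kpow k i)%:F.

(* BS(1,k,R) = R[1/k^R] x| R, as pairs (x,m) *)
Definition inBS (g : {fraction R} * R) : Prop := inLoc g.1.
Definition bs_mul (g h : {fraction R} * R) : {fraction R} * R :=
  (g.1 + h.1 * kpowF (- g.2), g.2 + h.2).
Definition bs_one : {fraction R} * R := (0, 0).
Definition bs_inv (g : {fraction R} * R) : {fraction R} * R :=
  (- (g.1 * kpowF g.2), - g.2).
End BS.

Definition Rgroup_exp (T : Type) (R : pzRingType) (inG : T -> Prop)
    (mul : T -> T -> T) (e : T) (inv : T -> T) (pw : T -> R -> T) : Prop :=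
  [/\ forall g a, inG g -> inG (pw g a),
      (forall g, inG g -> pw g 1 = g /\ pw g 0 = e) /\ (forall a, pw e a = e),
      forall g a b, inG g ->
        pw g (a + b) = mul (pw g a) (pw g b) /\ pw g (a * b) = pw (pw g a) b,
      forall g h a, inG g -> inG h ->
        pw (mul (mul (inv h) g) h) a = mul (mul (inv h) (pw g a)) h
    & forall g h a, inG g -> inG h -> mul g h = mul h g ->
        pw (mul g h) a = mul (pw g a) (pw h a)].

(* Main.v *)
(* Write G = BS(1,k,R) and read (x,m) as the affine map t |-> x + k^{-m} t. If
   m <> 0 this map has a unique fixed point t = x / (1 - k^{-m}) in Frac(R), so
   that (x,m) = (t (1 - k^{-m}), m); its power of exponent a is
   (t (1 - k^{-ma}), ma), while (x,0)^a = (a x, 0). The axioms follow because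
   commuting maps that are not both translations share their fixed point, and
   conjugation moves fixed points. The power stays in G because k^i - 1 divides
   k^{ia} - 1 in R for i, a >= 0. This divisibility and the laws of k^i are first
   order, hence inherited from Z, once exponentiation is known to be definable in
   Z: this uses Lagrange's four-square theorem, to define the order, and Goedel's
   coding of finite sets of integers by divisibility. *)

Require Import Defs.
From HB Require Import structures.
From mathcomp Require Import all_boot all_order all_algebra.
From mathcomp Require Import zify ring.
From Stdlib Require Import ClassicalEpsilon.
Set Implicit Arguments. Unset Strict Implicit. Unset Printing Implicit Defensive.
Import Order.TTheory GRing.Theory Num.Theory.
Local Open Scope ring_scope.

(** * Sums of four squares *)

Lemma nonnegR0 (R : pzSemiRingType) : nonnegR (0 : R).
Proof. by exists 0, 0, 0, 0; rewrite !mulr0 !addr0. Qed.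

(** Euler's four-square identity: the witnesses are the coordinates of a product of two quaternions,
    one of them conjugated, and the norm is multiplicative. *)
Lemma nonnegR_mul (R : comPzRingType) (i j : R) :
  nonnegR i -> nonnegR j -> nonnegR (i * j).
Proof.
move=> [a [b [c [d ->]]]] [a' [b' [c' [d' ->]]]].
exists (a * a' + b * b' + c * c' + d * d'), (a * b' - b * a' + c * d' - d * c').
exists (a * c' - c * a' + d * b' - b * d'), (a * d' - d * a' + b * c' - c * b').
by ring.
Qed.

(** Pigeonhole in ['F_p]: the values [a^2] and the values [-1 - b^2], for [a] and [b] up to [p./2],
    form two sets of [p./2 + 1] elements each, too many to be disjoint. *)
Lemma sum_two_squares_mod_prime (p : nat) : prime p ->
  exists a b : nat, [/\ (a <= p./2)%N, (b <= p./2)%N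
                     & (p %| 1 + a * a + b * b)%N].
Proof.
move=> pr_p; have p_gt1 := prime_gt1 pr_p.
have chp : p \in [pchar 'F_p] := pchar_Fp pr_p.
pose sq (a : 'I_(p./2).+1) : 'F_p := a%:R * a%:R.
have sq_inj : injective sq.
  move=> a b /eqP; rewrite -subr_eq0 /sq -!natrM => eq_ab; apply: val_inj => /=.
  wlog le_ab : a b eq_ab / (a <= b)%N.
    move=> IH; case/orP: (leq_total a b) => h; first exact: IH.
    by apply/esym/IH => //; rewrite -opprB oppr_eq0.
  move: eq_ab; rewrite -opprB oppr_eq0 -natrB ?leq_mul // -(dvdn_pcharf chp).
  rewrite !mulnn subn_sqr Euclid_dvdM //.
  have := ltn_ord a; have := ltn_ord b; have := odd_double_half p.
  move=> e2 lb la.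
  case/orP=> /dvdn_leq; lia.
pose A := [set sq a | a in setT]; pose B := [set -1 - sq a | a in setT].
have cA : #|A| = (p./2).+1 by rewrite card_imset // cardsT card_ord.
have cB : #|B| = (p./2).+1.
  rewrite card_imset ?cardsT ?card_ord // => a b /addrI /oppr_inj; exact: sq_inj.
have /set0Pn [x] : A :&: B != set0.
  apply/negP => /eqP e0; have := max_card (mem (A :|: B)).
  by rewrite cardsU e0 cards0 cA cB card_Fp //; lia.
rewrite inE => /andP [/imsetP [a _ ->] /imsetP [b _ e]].
exists a, b; split; try by rewrite -ltnS; exact: ltn_ord.
rewrite (dvdn_pcharf chp) !natrD !natrM -/(sq a) -/(sq b) e.
by apply/eqP; ring.
Qed.

Lemma centered_residue (m x : int) : 0 < m ->
  exists q y, [/\ x = y + m * q, 2 * y <= m & - m <= 2 * y].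
Proof.
move=> m0; have := divz_eq x m; have := modz_ge0 x (lt0r_neq0 m0).
have := ltz_pmod x m0; set q := (x %/ m)%Z; set y := (x %% m)%Z => h1 h2 h3.
case: (lerP (2 * y) m) => h; first by exists q, y; split; lia.
by exists (q + 1), (y - m); split; lia.
Qed.

Lemma prime_not_int_multiple (p m : nat) (c : int) :
  prime p -> (1 < m < p)%N -> p%:Z <> m%:Z * c.
Proof.
move=> pr_p /andP [m1 mp] e; have : (m %| p)%N.
  by apply/dvdnP; exists `|c|%N; rewrite mulnC -[p]/`|p%:Z|%N e abszM.
by case/primeP: pr_p => _ H /H /orP [] /eqP; lia.
Qed.

(** Lagrange's descent: centered residues [y_i] of the [x_i] modulo [m] have square sum [m r] with
    [r <= m], and Euler's identity applied to [(m p)(m r)] gives four squares of multiples of [m],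
    so that [m^2] can be divided out. Both [r = 0] and [r = m] would force [m] to divide [p]. *)
Lemma four_squares_descent (p m : nat) : prime p -> (1 < m < p)%N ->
  nonnegR (m%:Z * p%:Z) ->
  exists2 r : nat, (0 < r < m)%N & nonnegR (r%:Z * p%:Z).
Proof.
move=> pr_p /[dup] mp /andP [m1 _] [x1 [x2 [x3 [x4 ex]]]].
have m0 : 0 < m%:Z :> int by lia.
have [q1 [y1 [e1 h1 l1]]] := centered_residue x1 m0.
have [q2 [y2 [e2 h2 l2]]] := centered_residue x2 m0.
have [q3 [y3 [e3 h3 l3]]] := centered_residue x3 m0.
have [q4 [y4 [e4 h4 l4]]] := centered_residue x4 m0.
have bnd (y : int) : 2 * y <= m%:Z -> - m%:Z <= 2 * y ->
    4 * (y * y) <= m%:Z * m%:Z.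
  move=> h l; have : 0 <= (m%:Z - 2 * y) * (m%:Z + 2 * y) by rewrite mulr_ge0; lia.
  by rewrite mulrDr mulrBl mulrBl; lia.
have sq (y : int) : 0 <= y * y := sqr_ge0 y.
pose s := q1 * y1 + q2 * y2 + q3 * y3 + q4 * y4.
pose t := q1 * q1 + q2 * q2 + q3 * q3 + q4 * q4.
pose Y := y1 * y1 + y2 * y2 + y3 * y3 + y4 * y4.
(* Expanding the squares of [x_i = y_i + m q_i] gives [m p = Y + 2 m s + m^2 t]; solving for [Y / m]
   gives this value. *)
pose r : int := p%:Z - 2 * s - m%:Z * t.
have Yr : Y = m%:Z * r.
  by rewrite /r !mulrBr ex e1 e2 e3 e4 /Y /s /t; ring.
have Y4 : 4 * Y <= 4 * (m%:Z * m%:Z).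
  by have := bnd _ h1 l1; have := bnd _ h2 l2; have := bnd _ h3 l3;
     have := bnd _ h4 l4; rewrite /Y; lia.
have Y0 : 0 <= Y by rewrite /Y !addr_ge0.
have r0 : 0 <= r by move: Y0; rewrite Yr pmulr_rge0.
have rm : r <= m%:Z by move: Y4; rewrite Yr ler_pM2l // ler_pM2l.
have rN0 : r <> 0.
  move=> er; have y0 y : y * y <= Y -> y = 0.
    by rewrite Yr er mulr0 => h; apply/eqP; rewrite -sqrf_eq0 expr2 eq_le h sq.
  have := sq y1; have := sq y2; have := sq y3; have := sq y4 => s4 s3 s2 s1.
  have z1 : y1 = 0 by apply: y0; rewrite /Y; lia.
  have z2 : y2 = 0 by apply: y0; rewrite /Y; lia.
  have z3 : y3 = 0 by apply: y0; rewrite /Y; lia.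
  have z4 : y4 = 0 by apply: y0; rewrite /Y; lia.
  apply: (@prime_not_int_multiple p m t pr_p mp).
  by move: er; rewrite /r /s z1 z2 z3 z4; lia.
(* Here all four bounds [4 y_i^2 <= m^2] are equalities, so each [2 y_i] is [m] or [-m]; then [m]
   divides [2 s] and hence [p]. *)
have rNm : r <> m%:Z.
  move=> er; have Ym : Y = m%:Z * m%:Z by rewrite Yr er.
  have yp (y : int) : 2 * y <= m%:Z -> - m%:Z <= 2 * y ->
     4 * (y * y) = m%:Z * m%:Z -> exists u : int, 2 * y = m%:Z * u.
    move=> h l e; have : (2 * y) ^+ 2 == m%:Z ^+ 2 by rewrite !expr2; lia.
    by rewrite eqf_sqr => /orP [] /eqP ->; [exists 1 | exists (-1)]; lia.
  have b1 := bnd _ h1 l1; have b2 := bnd _ h2 l2.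
  have b3 := bnd _ h3 l3; have b4 := bnd _ h4 l4.
  have [u1 E1] : exists u : int, 2 * y1 = m%:Z * u.
    by apply: yp => //; rewrite /Y in Ym; lia.
  have [u2 E2] : exists u : int, 2 * y2 = m%:Z * u.
    by apply: yp => //; rewrite /Y in Ym; lia.
  have [u3 E3] : exists u : int, 2 * y3 = m%:Z * u.
    by apply: yp => //; rewrite /Y in Ym; lia.
  have [u4 E4] : exists u : int, 2 * y4 = m%:Z * u.
    by apply: yp => //; rewrite /Y in Ym; lia.
  apply: (@prime_not_int_multiple p m
           (1 + q1 * u1 + q2 * u2 + q3 * u3 + q4 * u4 + t) pr_p mp).
  have -> : p%:Z = r + 2 * s + m%:Z * t by rewrite /r; ring.
  have -> : 2 * s = q1 * (2 * y1) + q2 * (2 * y2) + q3 * (2 * y3) + q4 * (2 * y4).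
    by rewrite /s; ring.
  by rewrite er E1 E2 E3 E4; ring.
exists `|r|%N; first by lia.
have -> : `|r|%N%:Z = r by lia.
(* Euler's four expressions in the [x_i] and [y_i], divided by [m]: the first is
   [Y + m s = m (r + s)], and in the others the products of two [y_i] cancel. *)
exists (r + s), (q1 * y2 - q2 * y1 + q3 * y4 - q4 * y3),
  (q1 * y3 - q3 * y1 + q4 * y2 - q2 * y4), (q1 * y4 - q4 * y1 + q2 * y3 - q3 * y2).
have mm : m%:Z * m%:Z != 0 by lia.
apply: (mulfI mm).
transitivity ((m%:Z * p%:Z) * (m%:Z * r)); first by ring.
transitivity ((m%:Z * r + m%:Z * s) * (m%:Z * r + m%:Z * s) + m%:Z * m%:Z *
  ((q1 * y2 - q2 * y1 + q3 * y4 - q4 * y3) * (q1 * y2 - q2 * y1 + q3 * y4 - q4 * y3)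
 + (q1 * y3 - q3 * y1 + q4 * y2 - q2 * y4) * (q1 * y3 - q3 * y1 + q4 * y2 - q2 * y4)
 + (q1 * y4 - q4 * y1 + q2 * y3 - q3 * y2) * (q1 * y4 - q4 * y1 + q2 * y3 - q3 * y2)));
  last by ring.
by rewrite -Yr ex e1 e2 e3 e4 /Y /s; ring.
Qed.

Lemma four_squares_prime (p : nat) : prime p -> nonnegR (p%:Z : int).
Proof.
move=> pr_p; have p1 := prime_gt1 pr_p.
suff main (m : nat) : (0 < m < p)%N -> nonnegR (m%:Z * p%:Z) -> nonnegR (p%:Z : int).
  have [a [b [la lb /dvdnP [m em]]]] := sum_two_squares_mod_prime pr_p.
  have h2 := odd_double_half p.
  (* The bounds on [a] and [b] give [m p = 1 + a^2 + b^2 < p^2], hence [m < p]. *)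
  apply: (main m); first by nia.
  by exists 1, a%:Z, b%:Z, 0; rewrite -PoszM -em; lia.
elim/ltn_ind: m => m IH /andP [m0 mp] hm.
have [m1 | m1] := leqP m 1.
  have m1' : m = 1%N by lia.
  rewrite m1' mul1r in hm; exact: hm.
have [|r /andP [r0 rm] hr] := four_squares_descent pr_p _ hm; first by rewrite m1.
by apply: (IH r) => //; rewrite r0 (ltn_trans rm).
Qed.

(** Lagrange's theorem: the converse splits off the least prime factor and uses multiplicativity. *)
Lemma nonneg_intE (i : int) : nonnegR i <-> 0 <= i.
Proof.
split=> [[a [b [c [d ->]]]] | ].
  by rewrite !addr_ge0 // -expr2 sqr_ge0.
case: i => // n _; elim/ltn_ind: n => n IH.
have [n1 | n1] := leqP n 1.
  by exists n%:Z, 0, 0, 0; case: n n1 {IH} => [|[]].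
have := divnK (pdiv_dvd n); set d := pdiv n => dn.
have pr_d := pdiv_prime n1; rewrite -dn PoszM.
apply: nonnegR_mul; last exact: four_squares_prime.
by apply: IH; rewrite ltn_Pdiv ?prime_gt1 //; lia.
Qed.

(** * Transfer of first-order statements *)

Definition RImp (f g : rform) : rform := RNot (RAnd f (RNot g)).
Definition RAll (n : nat) (f : rform) : rform := RNot (REx n (RNot f)).

Section Semantics.
Variable R : pzSemiRingType.
Implicit Types (e : nat -> R) (f g : rform) (t : rterm).

Definition upd e n x : nat -> R := fun m => if m == n then x else e m.

Lemma fholds_eqt e a b x y : teval e a = x -> teval e b = y ->
  (fholds e (REq a b) <-> x = y).
Proof. by move=> <- <-. Qed.

Lemma fholds_and e f g P Q : (fholds e f <-> P) -> (fholds e g <-> Q) ->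
  (fholds e (RAnd f g) <-> P /\ Q).
Proof. by move=> /= -> ->. Qed.

Lemma fholds_imp e f g P Q : (fholds e f <-> P) -> (fholds e g <-> Q) ->
  (fholds e (RImp f g) <-> (P -> Q)).
Proof.
move=> <- <-; split=> [h hf | h [hf hg]]; last exact: hg (h hf).
by apply: NNPP => hg; apply: h.
Qed.

Lemma fholds_ex e n f P : (forall x, fholds (upd e n x) f <-> P x) ->
  (fholds e (REx n f) <-> exists x, P x).
Proof. by move=> h; split=> -[x /h hx]; exists x. Qed.

Lemma fholds_all e n f P : (forall x, fholds (upd e n x) f <-> P x) ->
  (fholds e (RAll n f) <-> forall x, P x).
Proof.
move=> hP; split=> [h x | h [x hx]]; last by apply: hx; apply/hP/h.
by apply/hP; apply: NNPP => hx; apply: h; exists x.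
Qed.

Lemma teval_eq e e' t :
  (forall n, tfree n t -> e n = e' n) -> teval e t = teval e' t.
Proof.
elim: t => //= [n|a IHa b IHb|a IHa b IHb] h; first exact: h (eqxx n).
  by rewrite IHa ?IHb // => n hn; apply: h; rewrite hn ?orbT.
by rewrite IHa ?IHb // => n hn; apply: h; rewrite hn ?orbT.
Qed.

Lemma fholds_eq e e' f :
  (forall n, ffree n f -> e n = e' n) -> fholds e f <-> fholds e' f.
Proof.
elim: f e e' => /= [a b|g IH|g IHg h IHh|m g IH] e e' eqe.
- by rewrite (@teval_eq e e' a) ?(@teval_eq e e' b) // => n hn;
    apply: eqe; rewrite hn ?orbT.
- by rewrite (IH e e').
- rewrite (IHg e e') ?(IHh e e') // => n hn; apply: eqe; rewrite hn ?orbT //.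
- split=> [[x]|[x]] hx; exists x; move: hx; apply IH => n hn;
    by case: eqP => // /eqP nm; rewrite eqe // nm.
Qed.

End Semantics.

Lemma tfree_bound t : exists N, forall n, tfree n t -> (n < N)%N.
Proof.
elim: t => [m|||a [A hA] b [B hB]|a [A hA] b [B hB]] /=; try by exists 0%N.
- by exists m.+1 => n /eqP ->.
- by exists (maxn A B) => n; rewrite leq_max => /orP [/hA|/hB] ->; rewrite ?orbT.
- by exists (maxn A B) => n; rewrite leq_max => /orP [/hA|/hB] ->; rewrite ?orbT.
Qed.

Lemma ffree_bound f : exists N, forall n, ffree n f -> (n < N)%N.
Proof.
elim: f => [a b|g [N hN]|g [A hA] h [B hB]|m g [N hN]] /=.
- have [A hA] := tfree_bound a; have [B hB] := tfree_bound b.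
  by exists (maxn A B) => n; rewrite leq_max => /orP [/hA|/hB] ->; rewrite ?orbT.
- by exists N.
- by exists (maxn A B) => n; rewrite leq_max => /orP [/hA|/hB] ->; rewrite ?orbT.
- by exists N => n /andP [_ /hN].
Qed.

(** Universal closure over the variables below [N]; it is needed because [elem_equiv_Z] compares
    sentences only. *)
Fixpoint close (N : nat) (f : rform) : rform :=
  if N is N'.+1 then close N' (RAll N' f) else f.

Lemma ffree_close N f n : ffree n (close N f) = (N <= n)%N && ffree n f.
Proof.
elim: N f => //= N IH f; rewrite IH /= andbA; congr (_ && _).
by rewrite ltn_neqAle andbC eq_sym.
Qed.

Lemma fholds_close (R : pzSemiRingType) N f (e : nat -> R) :
  fholds e (close N f) <->
  forall e', (forall n, (N <= n)%N -> e' n = e n) -> fholds e' f.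
Proof.
elim: N f e => [|N IH] f e /=.
  split=> [h e' ee'|]; last exact.
  by move: h; apply fholds_eq => n _; rewrite ee'.
rewrite IH; split=> h e' he'.
  (* Resetting entry [N] makes the environment agree with [e] from [N] on; the quantifier over
     variable [N] then restores [e' N]. *)
  have h' := h (upd e' N (e N)).
  have /h' : forall n, (N <= n)%N -> upd e' N (e N) n = e n.
    move=> n Nn; rewrite /upd; case: eqP => [-> //|/eqP nN].
    by apply: he'; rewrite ltn_neqAle eq_sym nN.
  move=> /(fholds_all (fun x => iff_refl _)) /(_ (e' N)); apply fholds_eq => n _; rewrite /upd.
  by case: eqP => // ->.
apply/(fholds_all (fun x => iff_refl _)) => x; apply: h => n Nn; rewrite /upd gtn_eqF //.
by apply: he'; apply: ltnW.
Qed.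

Lemma transfer (R : pzSemiRingType) (f : rform) : elem_equiv_Z R ->
  (forall e : nat -> int, fholds e f) -> forall e : nat -> R, fholds e f.
Proof.
move=> hR hZ e; have [N hN] := ffree_bound f.
have sf : sentence (close N f).
  by move=> n; rewrite ffree_close; apply/negP => /andP [Nn /hN]; rewrite ltnNge Nn.
have /(hR _ sf) : fholds (fun _ => 0 : int) (close N f) by apply/fholds_close.
(* The closure is evaluated in the zero environment, so it reaches only environments vanishing from
   [N] on; cutting [e] off there does not affect [f]. *)
move=> /fholds_close /(_ (fun n => if (n < N)%N then e n else 0)) h.
apply/(fholds_eq (e' := fun n => if (n < N)%N then e n else 0)).
  by move=> n /hN ->.
by apply: h => n; rewrite leqNgt => /negbTE ->.
Qed.

(** * Definability of exponentiation *)

(** A common prime factor divides [(j - i) b] with [b = (d.+2)!]; since [j - i <= d], it divides [b]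
    in either case, and therefore 1. *)
Lemma coprime_godel_moduli (d i j : nat) : (i <= d)%N -> (j <= d)%N -> i != j ->
  coprime (1 + i.+1 * (d.+2)`!) (1 + j.+1 * (d.+2)`!).
Proof.
wlog lt_ij : i j / (i < j)%N.
  move=> IH id jd ij; have [|h|/eqP] := ltngtP i j; first by move=> h; apply: IH.
    by rewrite coprime_sym; apply: IH; rewrite 1?eq_sym.
  by rewrite (negbTE ij).
move=> id jd _; set b := (d.+2)`!; rewrite /coprime; apply: contraT => g1.
have g0 : (0 < gcdn (1 + i.+1 * b) (1 + j.+1 * b))%N by rewrite gcdn_gt0.
have /pdivP [p pr_p] : (1 < gcdn (1 + i.+1 * b) (1 + j.+1 * b))%N.
  by rewrite ltn_neqAle eq_sym g1.
rewrite dvdn_gcd => /andP [pi pj].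
have pb : (p %| b)%N.
  have : (p %| (j - i) * b)%N.
    have -> : ((j - i) * b = (1 + j.+1 * b) - (1 + i.+1 * b))%N.
      by rewrite subnDl -mulnBl subSS.
    exact: dvdn_sub.
  rewrite Euclid_dvdM // => /orP [h|//]; apply: dvdn_fact.
  by rewrite prime_gt0 //=; have := dvdn_leq _ h; lia.
move: pi; rewrite (dvdn_addl _ (dvdn_mull _ pb)) dvdn1 => /eqP p1.
by rewrite p1 in pr_p.
Qed.

(** The code [a] is the product of the moduli indexed by [J]. Any other modulus is coprime to it and
    exceeds 1, so it cannot divide [a]. *)
Lemma godel_set_code (d : nat) (J : seq nat) : all (fun j => j <= d)%N J ->
  exists a b : nat, forall j, (j <= d)%N -> (1 + j.+1 * b %| a)%N = (j \in J).
Proof.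
move=> /allP Jd; pose b := (d.+2)`!.
exists (\prod_(j <- J) (1 + j.+1 * b))%N, b => j jd.
have [jJ|jJ] := boolP (j \in J); first by rewrite (big_rem j) //= dvdn_mulr.
apply/negP => h; suff cop : coprime (1 + j.+1 * b) (\prod_(i <- J) (1 + i.+1 * b)).
  have /eqP := gcdn_idPl h; rewrite (eqP cop).
  have := fact_gt0 d.+2; rewrite -/b; lia.
rewrite big_seq; elim/big_rec: _ => [|i x iJ IH]; first exact: coprimen1.
rewrite coprimeMr IH andbT coprime_godel_moduli //; first exact: Jd.
by apply: contraNneq jJ => ->.
Qed.

(* [n] belongs to the finite set of integers with code [(a, b, c, d)]; the
   shift [c] and the bound [d] confine Goedel's divisibility test to the range
   in which the moduli are pairwise coprime. *)
Definition coded (a b c d n : int) : Prop :=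
  0 <= n + c /\ n + c <= d /\ exists q, a = (1 + (n + c + 1) * b) * q.

Lemma godel_int_set_code (L : seq int) :
  exists a b c d : int, forall n : int, coded a b c d n <-> n \in L.
Proof.
pose N := \max_(n <- L) `|n|%N.
have LN n : n \in L -> (`|n| <= N)%N by move=> h; exact: leq_bigmax_seq.
pose J := [seq absz (n + N%:Z) | n <- L].
have Jd : all (fun j => j <= N.*2)%N J.
  by apply/allP => _ /mapP [n /LN nL ->]; lia.
have [a [b h]] := godel_set_code Jd.
exists a%:Z, b%:Z, N%:Z, N.*2%:Z => n.
split=> [[n0 [nd [q e]]]|nL].
  have : (absz (n + N%:Z) \in J).
    rewrite -h; last by lia.
    apply/dvdnP; exists `|q|%N; rewrite -[a]/`|a%:Z|%N e abszM mulnC.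
    have : n + N%:Z = (absz (n + N%:Z))%:Z by lia.
    move: (absz (n + N%:Z)) => w ->; congr (_ * _)%N.
    by have -> : 1 + (w%:Z + 1) * b%:Z = (1 + w.+1 * b)%N%:Z by lia.
  case/mapP => m mL e'; suff -> : n = m by [].
  by have := LN _ mL; lia.
have nN := LN _ nL; do 2 (split; first by lia).
have : absz (n + N%:Z) \in J by apply: map_f.
rewrite -h; last by lia.
case/dvdnP => q ->; exists q%:Z.
have : n + N%:Z = (absz (n + N%:Z))%:Z by lia.
by move: (absz (n + N%:Z)) => w ->; lia.
Qed.

(* A set containing the pair (0, 1) and closed under (i, u) |-> (i + 1, u y) for
   i < z must contain (z, y^z); the pair (i, u) with 0 <= i <= z is represented
   by u (z + 1) + i. *)
Lemma expz_coded (x y z : int) : 0 <= z ->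
  (x = y ^+ `|z|%N <-> forall a b c d,
     coded a b c d (z + 1) ->
     (forall i u, 0 <= i -> i + 1 <= z -> coded a b c d (u * (z + 1) + i) ->
        coded a b c d (u * y * (z + 1) + (i + 1))) ->
     coded a b c d (x * (z + 1) + z)).
Proof.
case: z => // m _; rewrite absz_nat; split=> [-> a b c d h0 hS|h].
  suff H (i : nat) : (i <= m)%N -> coded a b c d (y ^+ i * (m%:Z + 1) + i%:Z).
    exact: H.
  elim: i => [|i IH] im; first by rewrite expr0 mul1r addr0.
  rewrite exprSr (_ : i.+1%:Z = i%:Z + 1); last by lia.
  by apply: hS; [lia | lia | apply: IH; lia].
(* For the converse, the hypothesis is applied to the smallest such set, the graph of [i |-> y^i]
   for [i <= m]. *)
have [a [b [c [d hL]]]] :=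
  godel_int_set_code [seq y ^+ i * (m%:Z + 1) + i%:Z | i <- iota 0 m.+1].
(* The pairing is injective, since [j - i] is a multiple of [m + 1] of absolute value at most
   [m]. *)
have inj (u v : int) (i j : nat) : (i <= m)%N -> (j <= m)%N ->
    u * (m%:Z + 1) + i%:Z = v * (m%:Z + 1) + j%:Z -> u = v /\ i = j.
  move=> im jm e; have e1 : (u - v) * (m%:Z + 1) = j%:Z - i%:Z.
    by rewrite mulrBl; lia.
  suff uv : u = v by move: e; rewrite uv; lia.
  have [lt|lt|//] := ltrgtP u v.
    have : (v - u) * (m%:Z + 1) >= 1 * (m%:Z + 1) by rewrite ler_pM2r; lia.
    by rewrite -opprB mulNr e1; lia.
  have : (u - v) * (m%:Z + 1) >= 1 * (m%:Z + 1) by rewrite ler_pM2r; lia.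
  by rewrite e1; lia.
have /hL : coded a b c d (x * (m%:Z + 1) + m%:Z).
  apply: h => [|i u i0 im /hL].
    by apply/hL; apply/mapP; exists 0%N => //; rewrite expr0 mul1r addr0.
  case: i i0 im => // i _ im /mapP [j]; rewrite mem_iota /= add0n ltnS => jm.
  case/inj => //; first by lia.
  move=> -> ij; rewrite {}ij in im *; apply/hL/mapP; exists j.+1; first by rewrite mem_iota; lia.
  by rewrite exprSr; congr (_ + _); lia.
case/mapP => j; rewrite mem_iota /= add0n ltnS => jm.
by case/inj => // -> <-.
Qed.

(** A boolean test, so that freedom from capture is checked by computation on concrete terms. *)
Fixpoint tvars (P : pred nat) (t : rterm) : bool :=
  match t with
  | RVar n => P n
  | RZero | ROne => true
  | RAdd a b | RMul a b => tvars P a && tvars P b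
  end.

Lemma teval_vars (R : pzSemiRingType) (P : pred nat) (e e' : nat -> R) t :
  tvars P t -> (forall n, P n -> e n = e' n) -> teval e t = teval e' t.
Proof.
move=> vt ee'; apply: teval_eq => n hn; apply: ee'.
elim: t vt hn => //= [m|a IHa b IHb|a IHa b IHb]; first by move=> ? /eqP <-.
  by case/andP=> /IHa {}IHa /IHb {}IHb /orP [].
by case/andP=> /IHa {}IHa /IHb {}IHb /orP [].
Qed.

(** * Formulas for order, coded sets and exponentiation *)

Definition RSq (n : nat) : rterm := RMul (RVar n) (RVar n).

(* To avoid capture, the bound variables are 20 to 23 in [RNonneg], 10 in [RLe]
   and 11 in [RCoded]; variables 3 to 6 hold the code (a, b, c, d). *)
Definition RNonneg (t : rterm) : rform :=
  REx 20 (REx 21 (REx 22 (REx 23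
    (REq t (RAdd (RAdd (RAdd (RSq 20) (RSq 21)) (RSq 22)) (RSq 23)))))).

Definition RLe (s t : rterm) : rform :=
  REx 10 (RAnd (RNonneg (RVar 10)) (REq (RAdd s (RVar 10)) t)).

Definition RCoded (t : rterm) : rform :=
  let s := RAdd t (RVar 5) in
  RAnd (RNonneg s) (RAnd (RLe s (RVar 6))
    (REx 11 (REq (RVar 3)
      (RMul (RAdd ROne (RMul (RAdd s ROne) (RVar 4))) (RVar 11))))).

(** The criterion of [expz_coded] together with [0 <= z]; variables 7 and 8 run over the pairs
    [(i, u)]. *)
Definition exp_form : rform :=
  let x := RVar 0 in let y := RVar 1 in let z := RVar 2 in
  let i := RVar 7 in let u := RVar 8 in
  let z1 := RAdd z ROne in let i1 := RAdd i ROne in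
  RAnd (RNonneg z) (RAll 3 (RAll 4 (RAll 5 (RAll 6
    (RImp (RCoded z1)
    (RImp (RAll 7 (RAll 8
            (RImp (RNonneg i)
            (RImp (RLe i1 z)
            (RImp (RCoded (RAdd (RMul u z1) i))
                  (RCoded (RAdd (RMul (RMul u y) z1) i1)))))))
          (RCoded (RAdd (RMul x z1) z)))))))).

Lemma fholds_nonneg (R : pzSemiRingType) (e : nat -> R) t :
  tvars (fun n => n < 20)%N t -> (fholds e (RNonneg t) <-> nonnegR (teval e t)).
Proof.
move=> vt; do 4 apply: fholds_ex => ?; apply: fholds_eqt => //.
by apply: teval_vars vt _ => n n20; rewrite /upd !ltn_eqF //; lia.
Qed.

Lemma fholds_le (e : nat -> int) s t :
  tvars (fun n => n < 10)%N s -> tvars (fun n => n < 10)%N t ->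
  (fholds e (RLe s t) <-> teval e s <= teval e t).
Proof.
move=> vs vt; have E x r : tvars (fun n => n < 10)%N r ->
    teval (upd e 10%N x) r = teval e r.
  by move=> vr; apply: teval_vars vr _ => n n10; rewrite /upd ltn_eqF.
apply: (iff_trans (fholds_ex (P := fun x => nonnegR x /\ teval e s + x = teval e t) _)).
  move=> x; apply: fholds_and; first exact: fholds_nonneg.
  by apply: fholds_eqt => /=; rewrite E.
split=> [[x [/nonneg_intE x0 <-]] | h]; first by lia.
by exists (teval e t - teval e s); split; [apply/nonneg_intE|]; lia.
Qed.

Lemma fholds_coded (e : nat -> int) t : tvars (fun n => n < 10)%N t ->
  (fholds e (RCoded t) <-> coded (e 3%N) (e 4%N) (e 5%N) (e 6%N) (teval e t)).
Proof.
move=> vt; have wv : tvars (fun n => n < 20)%N t.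
  elim: t vt => //= [n n10|a IHa b IHb|a IHa b IHb]; first exact: ltn_trans n10 _.
    by case/andP=> /IHa -> /IHb.
  by case/andP=> /IHa -> /IHb.
apply: fholds_and; first by rewrite -nonneg_intE; apply: fholds_nonneg; rewrite /= wv.
apply: fholds_and; first by apply: fholds_le; rewrite /= ?vt.
apply: fholds_ex => q; apply: fholds_eqt => //=.
rewrite (teval_vars (e' := e) vt) // => n n10.
by rewrite /upd ltn_eqF // (ltn_trans n10).
Qed.

Lemma exp_formP : defines_exp exp_form.
Proof.
(* The indices 0 to 23 are tested one by one; no larger index occurs in the formula. *)
split; first by do 24 case=> //.
move=> e; rewrite /exp_form.
apply: (@iff_trans _ (0 <= e 2%N /\ forall a b c d,
     coded a b c d (e 2%N + 1) ->
     (forall i u, 0 <= i -> i + 1 <= e 2%N -> coded a b c d (u * (e 2%N + 1) + i) ->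
        coded a b c d (u * e 1%N * (e 2%N + 1) + (i + 1))) ->
     coded a b c d (e 0%N * (e 2%N + 1) + e 2%N))); last first.
  by split=> -[z0 h]; split=> //; apply/expz_coded.
apply: fholds_and; first by rewrite -nonneg_intE; apply: fholds_nonneg.
do 4 apply: fholds_all => ?.
apply: fholds_imp; first exact: fholds_coded.
apply: fholds_imp; last exact: fholds_coded.
do 2 apply: fholds_all => ?.
apply: fholds_imp; first by rewrite -nonneg_intE; apply: fholds_nonneg.
apply: fholds_imp; first exact: fholds_le.
by apply: fholds_imp; exact: fholds_coded.
Qed.

(** [Rexp] ranges over all defining formulas; the laws are transferred for this one formula, and
    [RexpE] links the two. *)
Definition exp_rel (R : pzSemiRingType) (x y z : R) : Prop :=
  fholds (env3 x y z) exp_form.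

(** Substitution of terms into [exp_form] is expressed by binding variables 0 to 2 and equating them
    with the terms, which must therefore avoid these variables. *)
Definition RExp (x y z : rterm) : rform :=
  REx 0 (REx 1 (REx 2 (RAnd (REq (RVar 0) x) (RAnd (REq (RVar 1) y)
    (RAnd (REq (RVar 2) z) exp_form))))).

Lemma fholds_exp (R : pzSemiRingType) (e : nat -> R) x y z :
  [&& tvars (leq 3) x, tvars (leq 3) y & tvars (leq 3) z] ->
  (fholds e (RExp x y z) <-> exp_rel (teval e x) (teval e y) (teval e z)).
Proof.
case/and3P=> vx vy vz.
have E a b c t : tvars (leq 3) t ->
    teval (upd (upd (upd e 0%N a) 1%N b) 2%N c) t = teval e t.
  by move=> vt; apply: teval_vars vt _ => -[|[|[|n]]].
apply: (@iff_trans _ (exists a b c, a = teval e x /\ (b = teval e y /\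
    (c = teval e z /\ fholds (upd (upd (upd e 0%N a) 1%N b) 2%N c) exp_form)))).
  do 3 apply: fholds_ex => ?.
  by do 3 (apply: fholds_and; first by apply: fholds_eqt => //; exact: E).
have F a b c : fholds (upd (upd (upd e 0%N a) 1%N b) 2%N c) exp_form <-> exp_rel a b c.
  by apply: fholds_eq => -[|[|[|n]]] // h; have := exp_formP.1 _ h.
split=> [[a [b [c [-> [-> [-> /F]]]]]] // | h].
exists (teval e x), (teval e y), (teval e z).
do 3 (split; first reflexivity).
by apply (proj2 (F _ _ _)).
Qed.

Lemma exp_rel_int (x y z : int) : exp_rel x y z <-> 0 <= z /\ x = y ^+ `|z|%N.
Proof. exact: exp_formP.2. Qed.

Definition RNum (n : nat) : rterm := iter n (RAdd ROne) RZero.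

Lemma teval_num (R : pzSemiRingType) (e : nat -> R) n : teval e (RNum n) = n%:R.
Proof. by elim: n => //= n ->; rewrite -natr1 addrC. Qed.

(** Stating [P] uniformly in the semiring lets one reading of [f] serve both for the integers and
    for [R]. *)
Lemma transferP (f : rform) (P : forall S : pzSemiRingType, (nat -> S) -> Prop) :
  (forall (S : pzSemiRingType) (e : nat -> S), fholds e f <-> P S e) ->
  (forall e : nat -> int, P int e) ->
  forall R : pzSemiRingType, elem_equiv_Z R -> forall e : nat -> R, P R e.
Proof.
move=> fP hZ R hR e; apply/fP; apply: transfer => // e'; exact/fP/hZ.
Qed.

(** * Laws of exponentiation inherited from the integers *)

Section Facts.
Variables (R : pzSemiRingType) (hR : elem_equiv_Z R).
Implicit Types x y z : R.

(** The padding makes the parameters start at index 3, clear of the variables bound by [RExp]. *)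
Local Notation env s := (nth 0 ([:: 0; 0; 0] ++ s)).
Local Notation V := RVar.

Lemma exp_rel_total y z : nonnegR z -> exists x, exp_rel x y z.
Proof.
refine (@transferP (RImp (RNonneg (V 3)) (REx 5 (RExp (V 5) (V 4) (V 3))))
  (fun S e => nonnegR (e 3%N) -> exists w, exp_rel w (e 4%N) (e 3%N)) _ _ R hR
  (env [:: z; y])); [move=> S e | move=> e /nonneg_intE z0].
  apply: fholds_imp; first exact: fholds_nonneg.
  by apply: fholds_ex => x; apply: fholds_exp.
by exists (e 4%N ^+ `|e 3%N|%N); apply/exp_rel_int.
Qed.

Lemma exp_rel_inj x x' y z : exp_rel x y z -> exp_rel x' y z -> x = x'.
Proof.
refine (@transferP (RImp (RExp (V 3) (V 5) (V 6)) (RImp (RExp (V 4) (V 5) (V 6))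
    (REq (V 3) (V 4))))
  (fun S e => exp_rel (e 3%N) (e 5%N) (e 6%N) -> exp_rel (e 4%N) (e 5%N) (e 6%N) -> e 3%N = e 4%N)
  _ _ R hR (env [:: x; x'; y; z])); [move=> S e | move=> e].
  by apply: fholds_imp; [|apply: fholds_imp => //]; exact: fholds_exp.
by move=> /exp_rel_int [_ ->] /exp_rel_int [_ ->].
Qed.

Lemma exp_relD x x' y z z' : exp_rel x y z -> exp_rel x' y z' ->
  exp_rel (x * x') y (z + z').
Proof.
refine (@transferP (RImp (RExp (V 3) (V 5) (V 6)) (RImp (RExp (V 4) (V 5) (V 7))
    (RExp (RMul (V 3) (V 4)) (V 5) (RAdd (V 6) (V 7)))))
  (fun S e => exp_rel (e 3%N) (e 5%N) (e 6%N) -> exp_rel (e 4%N) (e 5%N) (e 7%N) ->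
    exp_rel (e 3%N * e 4%N) (e 5%N) (e 6%N + e 7%N))
  _ _ R hR (env [:: x; x'; y; z; z'])); [move=> S e | move=> e].
  by do 2 (apply: fholds_imp; first exact: fholds_exp); exact: fholds_exp.
move=> /exp_rel_int [z0 ->] /exp_rel_int [z1 ->]; apply/exp_rel_int.
by split; [exact: addr_ge0 | rewrite -exprD; congr (_ ^+ _); lia].
Qed.

Lemma exp_rel_neq0 (k : nat) x z : (0 < k)%N -> exp_rel x k%:R z -> x <> 0.
Proof.
move=> k0; refine (@transferP (RImp (REq (V 4) (RNum k))
    (RImp (RExp (V 3) (V 4) (V 5)) (RNot (REq (V 3) RZero))))
  (fun S e => e 4%N = k%:R -> exp_rel (e 3%N) (e 4%N) (e 5%N) -> e 3%N <> 0)
  _ _ R hR (env [:: x; k%:R; z]) erefl); [move=> S e | move=> e ->].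
  apply: fholds_imp; first by apply: fholds_eqt => //; rewrite teval_num.
  by apply: fholds_imp => //; exact: fholds_exp.
by move=> /exp_rel_int [_ ->]; apply/eqP; rewrite expf_neq0 // pnatr_eq0 -lt0n.
Qed.

Lemma exp_rel_eq1 (k : nat) z : (1 < k)%N -> exp_rel 1 k%:R z -> z = 0.
Proof.
move=> k1; refine (@transferP (RImp (REq (V 4) (RNum k))
    (RImp (RExp ROne (V 4) (V 3)) (REq (V 3) RZero)))
  (fun S e => e 4%N = k%:R -> exp_rel 1 (e 4%N) (e 3%N) -> e 3%N = 0)
  _ _ R hR (env [:: z; k%:R]) erefl); [move=> S e | move=> e ->].
  apply: fholds_imp; first by apply: fholds_eqt => //; rewrite teval_num.
  by apply: fholds_imp => //; exact: fholds_exp.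
move=> /exp_rel_int [_ /esym/eqP]; rewrite -natrX pnatr_eq1 => /eqP e1.
have [//|z0] := eqVneq (e 3%N) 0.
have : (1 < k ^ `|e 3%N|%N)%N by rewrite -{1}(exp1n `|e 3%N|) ltn_exp2r // absz_gt0.
by rewrite e1.
Qed.

(** A subtraction-free form of [x' - 1 = q (x - 1)], as terms have no negation; over the integers
    [q] is the geometric sum of the powers of [x] below exponent [a]. *)
Lemma exp_rel_div x x' y z a : exp_rel x y z -> exp_rel x' y (z * a) ->
  nonnegR a -> exists q, x' + q = 1 + q * x.
Proof.
refine (@transferP (RImp (RExp (V 3) (V 5) (V 6)) (RImp
    (RExp (V 4) (V 5) (RMul (V 6) (V 7))) (RImp (RNonneg (V 7))
    (REx 8 (REq (RAdd (V 4) (V 8)) (RAdd ROne (RMul (V 8) (V 3))))))))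
  (fun S e => exp_rel (e 3%N) (e 5%N) (e 6%N) -> exp_rel (e 4%N) (e 5%N) (e 6%N * e 7%N) ->
    nonnegR (e 7%N) -> exists q, e 4%N + q = 1 + q * e 3%N)
  _ _ R hR (env [:: x; x'; y; z; a])); [move=> S e | move=> e].
  do 2 (apply: fholds_imp; first exact: fholds_exp).
  by apply: fholds_imp; [exact: fholds_nonneg | apply: fholds_ex].
move=> /exp_rel_int [z0 ->] /exp_rel_int [_ ->] /nonneg_intE a0.
rewrite abszM exprM; set u := e 5%N ^+ _; set n := `|e 7%N|%N.
exists (\sum_(i < n) u ^+ i); move: (subrX1 u n); set q := \sum_(i < n) _ => eq_q.
by rewrite -[u ^+ n](subrK 1) eq_q; ring.
Qed.

Lemma nonnegRD y z : nonnegR y -> nonnegR z -> nonnegR (y + z).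
Proof.
refine (@transferP (RImp (RNonneg (V 3)) (RImp (RNonneg (V 4))
    (RNonneg (RAdd (V 3) (V 4)))))
  (fun S e => nonnegR (e 3%N) -> nonnegR (e 4%N) -> nonnegR (e 3%N + e 4%N))
  _ _ R hR (env [:: y; z])); [move=> S e | move=> e].
  by do 2 (apply: fholds_imp; first exact: fholds_nonneg); exact: fholds_nonneg.
by move=> /nonneg_intE y0 /nonneg_intE z0; apply/nonneg_intE/addr_ge0.
Qed.

Lemma nonnegR_total y z : y + z = 0 -> ~ nonnegR y -> nonnegR z.
Proof.
refine (@transferP (RImp (REq (RAdd (V 3) (V 4)) RZero)
    (RImp (RNot (RNonneg (V 3))) (RNonneg (V 4))))
  (fun S e => e 3%N + e 4%N = 0 -> ~ nonnegR (e 3%N) -> nonnegR (e 4%N))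
  _ _ R hR (env [:: y; z])); [move=> S e | move=> e e0].
  apply: fholds_imp => //; apply: fholds_imp; last exact: fholds_nonneg.
  exact: not_iff_compat (fholds_nonneg _ _).
by rewrite !nonneg_intE; lia.
Qed.

(** Any two formulas defining exponentiation are equivalent over the integers, and this equivalence
    transfers to [R]. *)
Lemma RexpE x y z : Rexp x y z <-> exp_rel x y z.
Proof.
split=> [[phi [[dphi1 dphi] h]] | h]; last by exists exp_form; split=> //; exact: exp_formP.
have {}h := h : fholds (env3 x y z) phi.
move: h; apply: (fholds_imp (iff_refl _) (iff_refl _)).1; apply: transfer => // e.
apply/(fholds_imp (dphi e) (exp_formP.2 e)); exact.
Qed.

Lemma kpowP (k : nat) z : nonnegR z -> exp_rel (kpow k z) k%:R z.
Proof.
move=> /(exp_rel_total k%:R) [x hx]; apply/RexpE; rewrite /kpow.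
by apply: (epsilon_spec (inhabits 0) (fun w => Rexp w k%:R z)); exists x; apply/RexpE.
Qed.

End Facts.

(** * The group *)

(** Meant for [u = k^i] and [w = k^(i a)]: replacing [i] by [-i] inverts both and changes the ratio
    by the unit [w / u]. *)
Lemma invr_ratio (F : fieldType) (u w : F) : u != 0 -> w != 0 -> 1 - u != 0 ->
  (1 - w) / (1 - u) = (1 - w^-1) / (1 - u^-1) * (w * u^-1).
Proof.
move=> u0 w0 d0; have d1 : u - 1 != 0 by rewrite -opprB oppr_eq0.
by field; apply/and4P.
Qed.

Section Group.
Variables (k : nat) (k_gt1 : (1 < k)%N) (R : idomainType).
Hypothesis hR : elem_equiv_Z R.
Local Notation K := (@kpow R k).
Local Notation kap := (@kpowF R k).
Local Notation "x %:F" := (@FracField.tofrac R x).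
Local Notation inL := (@inLoc R k).
Implicit Types (i j m n a b : R) (x y t : {fraction R}).

Lemma kpowD i j : nonnegR i -> nonnegR j -> K (i + j) = K i * K j.
Proof.
move=> hi hj; apply: (exp_rel_inj hR (kpowP hR k (nonnegRD hR hi hj))).
exact: (exp_relD hR) (kpowP hR k hi) (kpowP hR k hj).
Qed.

Lemma kpow_neq0 i : nonnegR i -> (K i)%:F != 0.
Proof.
move=> hi; rewrite tofrac_eq0; apply/eqP.
exact: (exp_rel_neq0 hR (ltnW k_gt1) (kpowP hR k hi)).
Qed.

Lemma kpow_eq1 i : nonnegR i -> K i = 1 -> i = 0.
Proof.
by move=> hi e; have := kpowP hR k hi; rewrite e; apply: exp_rel_eq1.
Qed.

Lemma nonnegR_oppP i : nonnegR i \/ nonnegR (- i).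
Proof.
case: (classic (nonnegR i)) => h; [by left | right].
by apply: (nonnegR_total hR _ h); rewrite subrr.
Qed.

Lemma kpowF_cases i :
  (nonnegR i -> kap i = (K i)%:F) /\ (~ nonnegR i -> kap i = ((K (- i))%:F)^-1).
Proof.
rewrite /kpowF; apply: (epsilon_spec (inhabits 0) (fun y : {fraction R} =>
    (nonnegR i -> y = (K i)%:F) /\ (~ nonnegR i -> y = ((K (- i))%:F)^-1))).
case: (classic (nonnegR i)) => h; first by exists (K i)%:F; split.
by exists ((K (- i))%:F)^-1; split.
Qed.

(** Every exponent is a difference of nonnegative ones, so this confines the sign analysis of [kap]
    to one place. *)
Lemma kpowF_sub i j : nonnegR i -> nonnegR j ->
  kap (i - j) = (K i)%:F / (K j)%:F.
Proof.
move=> hi hj; have [h1 h2] := kpowF_cases (i - j).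
case: (classic (nonnegR (i - j))) => h.
  rewrite h1 //; apply: (canRL (mulfK (kpow_neq0 hj))).
  by rewrite -tofracM -kpowD // subrK.
have h' : nonnegR (j - i).
  by rewrite -opprB; case: (nonnegR_oppP (i - j)).
rewrite h2 // opprB; apply: (canRL (mulfK (kpow_neq0 hj))).
apply: (canLR (mulKf (kpow_neq0 h'))).
by rewrite -tofracM -kpowD // subrK.
Qed.

Lemma nonnegR_diff i : exists a b, [/\ nonnegR a, nonnegR b & i = a - b].
Proof.
have z0 := nonnegR0 R.
case: (nonnegR_oppP i) => h; [exists i, 0 | exists 0, (- i)].
  by rewrite subr0.
by rewrite sub0r opprK.
Qed.

Lemma kpowF_neq0 i : kap i != 0.
Proof.
have [a [b [ha hb ->]]] := nonnegR_diff i.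
by rewrite kpowF_sub // mulf_neq0 ?invr_eq0 ?kpow_neq0.
Qed.

Lemma kpowFD i j : kap (i + j) = kap i * kap j.
Proof.
have [a [b [ha hb ->]]] := nonnegR_diff i.
have [c [d [hc hd ->]]] := nonnegR_diff j.
rewrite addrACA -opprD !kpowF_sub ?kpowD //; try exact: (nonnegRD hR).
by rewrite !tofracM mulf_div.
Qed.

Lemma kpowF0 : kap 0 = 1.
Proof. by apply: (mulfI (kpowF_neq0 0)); rewrite -kpowFD addr0 mulr1. Qed.

Lemma kpowFN i : kap (- i) = (kap i)^-1.
Proof.
by apply: (mulfI (kpowF_neq0 i)); rewrite -kpowFD subrr kpowF0 mulfV ?kpowF_neq0.
Qed.

Lemma kpowF_nonneg i : nonnegR i -> kap i = (K i)%:F.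
Proof. exact: (kpowF_cases i).1. Qed.

Lemma kpowF_eq1 i : kap i = 1 -> i = 0.
Proof.
have H j : nonnegR j -> kap j = 1 -> j = 0.
  move=> hj; rewrite kpowF_nonneg // => /eqP.
  by rewrite -tofrac1 tofrac_eq => /eqP /kpow_eq1 ->.
case: (nonnegR_oppP i) => h e; first exact: H.
by apply: oppr_inj; rewrite oppr0; apply: H => //; rewrite kpowFN e invr1.
Qed.

Lemma inLoc_kpowF i : inL (kap i).
Proof.
have [a [b [ha hb ->]]] := nonnegR_diff i.
by exists (K a), b; rewrite kpowF_sub.
Qed.

Lemma inLoc_tofrac a : inL a%:F.
Proof.
have z0 := nonnegR0 R.
by exists a, 0; split=> //; rewrite -(kpowF_nonneg z0) kpowF0 divr1.
Qed.

Lemma inLocM x y : inL x -> inL y -> inL (x * y).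
Proof.
move=> [a [i [hi ->]]] [b [j [hj ->]]]; exists (a * b), (i + j).
by split; [exact: (nonnegRD hR) | rewrite kpowD // !tofracM mulf_div].
Qed.

(** By [exp_rel_div] the ratio is already the image of an element of [R]. *)
Lemma inLoc_ratio_nonneg i a : i <> 0 -> nonnegR i -> nonnegR a ->
  inL ((1 - kap (i * a)) / (1 - kap i)).
Proof.
move=> i0 hi ha; have hia := nonnegR_mul hi ha.
have [q e] := exp_rel_div hR (kpowP hR k hi) (kpowP hR k hia) ha.
suff -> : (1 - kap (i * a)) / (1 - kap i) = q%:F by exact: inLoc_tofrac.
have d0 : 1 - kap i != 0 by apply/eqP => /subr0_eq /esym /kpowF_eq1.
apply: (canLR (mulfK d0)); rewrite !kpowF_nonneg // -tofrac1 -!tofracB -tofracM.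
by congr _%:F; rewrite -(addrK q (K (i * a))) e; ring.
Qed.

(* Changing the sign of [i] or [a] multiplies the ratio by a unit +-k^j. *)
Lemma inLoc_ratio i a : i <> 0 -> inL ((1 - kap (i * a)) / (1 - kap i)).
Proof.
have oppL x : inL x -> inL (- x).
  move=> hx; have := inLocM (inLoc_tofrac (- 1)) hx.
  by rewrite tofracN tofrac1 mulN1r.
wlog hi : i / nonnegR i => [IH i0|i0].
  case: (nonnegR_oppP i) => h; first exact: IH.
  have Ni0 : - i <> 0 by move/eqP; rewrite oppr_eq0 => /eqP.
  have d0 : 1 - kap i != 0 by apply/eqP => /subr0_eq /esym /kpowF_eq1.
  have -> : (1 - kap (i * a)) / (1 - kap i) =
      (1 - kap (- i * a)) / (1 - kap (- i)) * (kap (i * a) * kap (- i)).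
    by rewrite mulNr !kpowFN; apply: invr_ratio; rewrite ?kpowF_neq0.
  by apply: inLocM; [exact: IH | apply: inLocM; exact: inLoc_kpowF].
case: (nonnegR_oppP a) => ha; first exact: inLoc_ratio_nonneg.
have -> : (1 - kap (i * a)) / (1 - kap i) =
    - ((1 - kap (i * - a)) / (1 - kap i) * kap (i * a)).
  rewrite mulrN kpowFN mulrAC -mulNr; congr (_ / _).
  by rewrite mulrBl mul1r mulVf ?kpowF_neq0 // opprB.
by apply: oppL; apply: inLocM (inLoc_kpowF _); exact: inLoc_ratio_nonneg.
Qed.

(** For a standard natural number [a] the quotient is the geometric sum of [k^(-m i)] over [i < a],
    with [m = g.2], as in the ordinary power. *)
Definition bs_pow (g : {fraction R} * R) a : {fraction R} * R :=
  if g.2 == 0 then (g.1 * a%:F, 0)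
  else (g.1 * ((1 - kap (- (g.2 * a))) / (1 - kap (- g.2))), g.2 * a).

Lemma sub1_kpowF_neq0 m : m <> 0 -> 1 - kap (- m) != 0.
Proof.
move=> m0; apply/eqP => /subr0_eq /esym /kpowF_eq1 /eqP; rewrite oppr_eq0.
by move/eqP.
Qed.

(* A pair is either a translation [(x, 0)] or lies in the one-parameter group
   of affine maps fixing a point [t]. *)
Definition bs_fix t m : {fraction R} * R := (t * (1 - kap (- m)), m).

Lemma bs_cases (g : {fraction R} * R) :
  (exists x, g = (x, 0)) \/ (exists t m, m <> 0 /\ g = bs_fix t m).
Proof.
case: g => x m; have [->|/eqP m0] := eqVneq m 0; first by left; exists x.
right; exists (x / (1 - kap (- m))), m; split=> //.
by rewrite /bs_fix divfK // sub1_kpowF_neq0.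
Qed.

Lemma bs_pow_trans x a : bs_pow (x, 0) a = (x * a%:F, 0).
Proof. by rewrite /bs_pow eqxx. Qed.

(** The case [m = 0], where [bs_fix t 0] is the identity, is included because an iterated power can
    pass through exponent 0. *)
Lemma bs_pow_fix t m a : bs_pow (bs_fix t m) a = bs_fix t (m * a).
Proof.
rewrite /bs_pow /bs_fix /=; have [->|/eqP m0] := eqVneq m 0.
  by rewrite mul0r oppr0 kpowF0 subrr mulr0 mul0r.
by congr (_, _); rewrite mulrA mulrAC mulfK // sub1_kpowF_neq0.
Qed.

Lemma bs_mul_fix t m n : bs_mul k (bs_fix t m) (bs_fix t n) = bs_fix t (m + n).
Proof.
by rewrite /bs_mul /bs_fix /= opprD kpowFD; congr (_, _); ring.
Qed.

Lemma bs_mul_trans x y : bs_mul k (x, 0) (y, 0) = (x + y, 0).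
Proof. by rewrite /bs_mul /= oppr0 kpowF0 mulr1 addr0. Qed.

(** The new fixed point is the image of [t] under the inverse of the affine map [h]. *)
Lemma bs_conj_fix t m (h : {fraction R} * R) :
  bs_mul k (bs_mul k (bs_inv k h) (bs_fix t m)) h =
  bs_fix (kap h.2 * (t - h.1)) m.
Proof.
case: h => y n; rewrite /bs_mul /bs_inv /bs_fix /= opprK opprD !kpowFD opprK.
by congr (_, _); ring.
Qed.

Lemma bs_conj_trans x (h : {fraction R} * R) :
  bs_mul k (bs_mul k (bs_inv k h) (x, 0)) h = (kap h.2 * x, 0).
Proof.
case: h => y n; rewrite /bs_mul /bs_inv /= !addr0 opprK.
by congr (_, _); ring.
Qed.

(** A map commuting with one whose only fixed point is [t] must fix [t]; in coordinates this is
    cancellation of [1 - k^(-m)]. *)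
Lemma bs_comm_fix t m (h : {fraction R} * R) : m <> 0 ->
  bs_mul k (bs_fix t m) h = bs_mul k h (bs_fix t m) -> h = bs_fix t h.2.
Proof.
move=> m0; case: h => y n [e _]; congr (_, _) => /=.
apply: (mulIf (sub1_kpowF_neq0 m0)).
transitivity (y - (t * (1 - kap (- m)) + y * kap (- m)) + t * (1 - kap (- m))).
  by ring.
by rewrite e; ring.
Qed.

Lemma bs_pow_inBS (g : {fraction R} * R) a : inBS k g -> inBS k (bs_pow g a).
Proof.
case: g => x m; rewrite /inBS /bs_pow /= => hx.
have [_|/eqP m0] := eqVneq m 0; apply: inLocM => //; first exact: inLoc_tofrac.
by rewrite -mulNr; apply: inLoc_ratio => /eqP; rewrite oppr_eq0 => /eqP.
Qed.

Lemma bs_powM_comm g h a : bs_mul k g h = bs_mul k h g ->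
  bs_pow (bs_mul k g h) a = bs_mul k (bs_pow g a) (bs_pow h a).
Proof.
case: (bs_cases g) => [[x ->]|[t [m [m0 ->]]]]; last first.
  (* If [h] is a translation, this makes it [bs_fix t 0], the identity. *)
  move=> /(bs_comm_fix m0) ->.
  by rewrite bs_mul_fix !bs_pow_fix bs_mul_fix mulrDl.
case: (bs_cases h) => [[y ->] _|[t [m [m0 ->]]] /esym /(bs_comm_fix m0) ->].
  by rewrite bs_mul_trans !bs_pow_trans bs_mul_trans mulrDl.
by rewrite bs_mul_fix !bs_pow_fix bs_mul_fix mulrDl.
Qed.
End Group.

Theorem theorem5p2 (k : nat) (hk : (1 < k)%N) (R : idomainType)
  (hR : elem_equiv_Z R) :
  exists pw : {fraction R} * R -> R -> {fraction R} * R,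
    Rgroup_exp (inBS k) (bs_mul k) (bs_one R) (bs_inv k) pw.
Proof.
(* The power multiplies [x] by [a] on translations and [m] by [a] on [bs_fix t m], so axioms (1) to
   (3) reduce to ring identities in each case of [bs_cases]. *)
exists (@bs_pow k R); split.
- by move=> g a; apply: bs_pow_inBS.
- split=> [g _|a]; last by rewrite bs_pow_trans mul0r.
  case: (bs_cases hk hR g) => [[x ->]|[t [m [m0 ->]]]].
    by rewrite !bs_pow_trans tofrac1 tofrac0 mulr1 mulr0.
  rewrite !(bs_pow_fix hk hR) mulr1 mulr0; split=> //.
  by rewrite /bs_fix oppr0 (kpowF0 hk hR) subrr mulr0.
- move=> g a b _; case: (bs_cases hk hR g) => [[x ->]|[t [m [m0 ->]]]].
    rewrite !bs_pow_trans (bs_mul_trans hk hR); split.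
      by rewrite tofracD mulrDr.
    by rewrite tofracM mulrA.
  by rewrite !(bs_pow_fix hk hR) (bs_mul_fix hk hR) mulrDr mulrA.
- move=> g h a _ _; case: (bs_cases hk hR g) => [[x ->]|[t [m [m0 ->]]]].
    by rewrite bs_conj_trans !bs_pow_trans bs_conj_trans mulrA.
  by rewrite (bs_conj_fix hk hR) !(bs_pow_fix hk hR) (bs_conj_fix hk hR).
- by move=> g h a _ _; apply: bs_powM_comm.
Qed.
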